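(* For every natural number $n\ge2$, $\mathbf{N}\mathbf{A}_{0,n}\nvdash\neg\Box^{n+1}\bot$. Consequently, $\mathbf{N}\mathbf{A}_{0,n}\subsetneq\mathbf{N}^+\mathbf{A}_{0,n}$ (as sets of theorems).
   Context: Language: modal formulae are built from propositional variables, the constant $\bot$, $\neg$, $\lor$, and $\Box$; $\varphi\to\psi$ abbreviates $\neg\varphi\lor\psi$. $\Box^0\varphi=\varphi$ and $\Box^{k+1}\varphi=\Box\Box^k\varphi$. Logics: $\mathbf{N}$ has as axioms all propositional tautologies in the modal language and as rules modus ponens and necessitation (from $\varphi$ infer $\Box\varphi$). $\mathbf{N}\mathbf{A}_{m,n}$ is $\mathbf{N}$ plus the axiom scheme $\Box^n\varphi\to\Box^m\varphi$ (all formulae $\varphi$); so $\mathbf{N}\mathbf{A}_{0,n}$ has the scheme $\Box^n\varphi\to\varphi$. $\mathbf{N}^+\mathbf{A}_{m,n}$ is $\mathbf{N}\mathbf{A}_{m,n}$ plus the rule $\mathrm{Ros}^\Box$: from $\neg\Box\varphi$ infer $\neg\Box\Box\varphi$. *)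

(* Defs.v *)
From mathcomp Require Import all_boot.

Set Implicit Arguments.
Unset Strict Implicit.
Unset Printing Implicit Defensive.

Inductive form : Type :=
| Var of nat
| Bot
| Neg of form
| Or of form & form
| Box of form.

Definition Imp (a b : form) : form := Or (Neg a) b.

Definition boxn (k : nat) (a : form) : form := iter k Box a.

(* Boolean value of a modal formula when its variables and its boxed
   subformulae are all treated as propositional atoms, valued by [v]. *)
Fixpoint peval (v : form -> bool) (a : form) : bool :=
  match a with
  | Var _ => v a
  | Bot => false
  | Neg b => ~~ peval v b
  | Or b c => peval v b || peval v c
  | Box _ => v a
  end.

Definition tautology (a : form) : Prop := forall v : form -> bool, peval v a.

Inductive NA (m n : nat) : form -> Prop :=
| NA_taut a : tautology a -> NA m n a
| NA_acc a : NA m n (Imp (boxn n a) (boxn m a))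
| NA_mp a b : NA m n (Imp a b) -> NA m n a -> NA m n b
| NA_nec a : NA m n a -> NA m n (Box a).

Inductive NplusA (m n : nat) : form -> Prop :=
| NplusA_taut a : tautology a -> NplusA m n a
| NplusA_acc a : NplusA m n (Imp (boxn n a) (boxn m a))
| NplusA_mp a b : NplusA m n (Imp a b) -> NplusA m n a -> NplusA m n b
| NplusA_nec a : NplusA m n a -> NplusA m n (Box a)
| NplusA_ros a : NplusA m n (Neg (Box a)) -> NplusA m n (Neg (Box (Box a))).

Definition strict_sublogic (L L' : form -> Prop) : Prop :=
  (forall a, L a -> L' a) /\ exists a, L' a /\ ~ L a.

(* Main.v *)
(** For the unprovability, take two worlds [true] and [false], both of which
    satisfy [Box a] whenever [a] is valid (true in both worlds), and let the
    world [true] satisfy in addition [Box Bot] and [boxn n.+1 Bot].  In the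
    world [false] every true boxed formula has a valid body, so validity of
    [boxn k a] descends to validity of [a]; hence [boxn n a -> a] can only fail
    at [true] through one of the two exceptional formulae.  For [2 <= n] the
    formula [boxn n a] is never [Box Bot], and it is [boxn n.+1 Bot] only for
    [a = Box Bot], which is true there. *)

Require Import Defs.
From mathcomp Require Import all_boot.

(** A structural test for [a = boxn k Bot], so that [form] needs no decidable equality. *)
Fixpoint is_boxn_bot (k : nat) (a : form) : bool :=
  match k, a with
  | 0, Bot => true
  | k'.+1, Box b => is_boxn_bot k' b
  | _, _ => false
  end.

Lemma is_boxn_bot_boxn k : is_boxn_bot k (boxn k Bot).
Proof. by elim: k. Qed.

Lemma is_boxn_bot_add k j a : is_boxn_bot (k + j) (boxn k a) = is_boxn_bot j a.
Proof. by elim: k => //= k ->. Qed.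

Fixpoint sat (n : nat) (a : form) (w : bool) : bool :=
  match a with
  | Var _ => false
  | Bot => false
  | Neg b => ~~ sat n b w
  | Or b c => sat n b w || sat n c w
  | Box b => sat n b true && sat n b false
             || w && (is_boxn_bot 0 b || is_boxn_bot n b)
  end.

Definition valid (n : nat) (a : form) : Prop := forall w, sat n a w.

Lemma peval_sat n w a : peval (fun b => sat n b w) a = sat n a w.
Proof. by elim: a => //= [a -> | a -> b ->]. Qed.

Lemma sat_Box_false n a : sat n (Box a) false -> valid n a.
Proof. by rewrite /= orbF => /andP[? ?] []. Qed.

Lemma valid_boxn n k a : valid n (boxn k a) -> valid n a.
Proof.
elim: k => //= k IHk /(_ false) Hk.
exact/IHk/sat_Box_false.
Qed.

Lemma sat_boxn n a w : 2 <= n -> sat n (boxn n a) w -> sat n a w.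
Proof.
case: n => [|[|k]] // _ /= /orP[/andP[Ht Hf] | /andP[-> /= Ha]].
  by apply: (@valid_boxn _ k.+1) => -[].
(* Here [boxn k.+1 a] is [boxn k.+2 Bot]; cancelling [k.+1] boxes leaves [a = Box Bot], true at
   [true]. *)
by move: Ha (is_boxn_bot_add k 1 a); rewrite addn1 /= => ->; case: a => // -[].
Qed.

Lemma NA_valid n a : 2 <= n -> NA 0 n a -> valid n a.
Proof.
move=> hn; elim=> {a} [a taut_a | a | a b _ IHab _ IHa | a _ IHa] w.
- by rewrite -peval_sat.
- by rewrite /= -implybE; apply/implyP/sat_boxn.
- by have := IHab w; rewrite /= IHa.
- by rewrite /= !IHa.
Qed.

Lemma NA_NplusA m n a : NA m n a -> NplusA m n a.
Proof.
elim=> {a} [a taut_a | a | a b _ IHab _ IHa | a _ IHa].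
- exact: NplusA_taut.
- exact: NplusA_acc.
- exact: NplusA_mp IHab IHa.
- exact: NplusA_nec.
Qed.

Lemma NplusA_not_boxn_Bot n : NplusA 0 n (Neg (boxn n Bot)).
Proof.
(* Since [boxn 0 Bot] is [Bot], the axiom refutes [boxn n Bot]. *)
apply: (NplusA_mp _ (NplusA_acc 0 n Bot)).
by apply: NplusA_taut => v /=; rewrite orbF orNb.
Qed.

Theorem proposition4p5 (n : nat) (hn : 2 <= n) :
  ~ NA 0 n (Neg (boxn n.+1 Bot)) /\ strict_sublogic (NA 0 n) (NplusA 0 n).
Proof.
have unprov : ~ NA 0 n (Neg (boxn n.+1 Bot)).
  by move/(NA_valid _ _ hn)/(_ true); rewrite /= is_boxn_bot_boxn !orbT.
split=> //; split; first exact: NA_NplusA.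
exists (Neg (boxn n.+1 Bot)); split=> //.
(* As [n] is positive, [boxn n Bot] begins with a box, so the Rosser rule can add one more. *)
by case: n hn {unprov} => // n _; apply/NplusA_ros/NplusA_not_boxn_Bot.
Qed.
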